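(* Let $\Sigma$ be a nonempty set, let $n\ge 4$, and let $q,f:\Sigma^n\to\Sigma$ be reducible $n$-quasigroups. Let $(o_1,\ldots,o_n)\in\Sigma^n$. Assume that for every $i\in\{1,\ldots,n\}$ and every $(x_1,\ldots,x_n)\in\Sigma^n$, $$q(x_1,\ldots,x_{i-1},o_i,x_{i+1},\ldots,x_n)=f(x_1,\ldots,x_{i-1},o_i,x_{i+1},\ldots,x_n).$$ Then $q(x_1,\ldots,x_n)=f(x_1,\ldots,x_n)$ for all $(x_1,\ldots,x_n)\in\Sigma^n$.
   Context: For a nonempty set $\Sigma$ and a positive integer $n$, an $n$-ary operation $f:\Sigma^n\to\Sigma$ is an $n$-quasigroup if in the equality $z_0=f(z_1,\ldots,z_n)$ knowledge of any $n$ of the elements $z_0,\ldots,z_n$ uniquely specifies the remaining one. An $n$-quasigroup $f$ is (permutably) reducible if there exist an integer $k$ with $1<k<n$, a permutation $\sigma$ of $\{1,\ldots,n\}$, an $(n-k+1)$-quasigroup $h$ and a $k$-quasigroup $g$ on $\Sigma$ such that $f(x_1,\ldots,x_n)=h\big(g(x_{\sigma(1)},\ldots,x_{\sigma(k)}),x_{\sigma(k+1)},\ldots,x_{\sigma(n)}\big)$ for all $x_1,\ldots,x_n\in\Sigma$. *)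

(* Defs.v *)
From mathcomp Require Import all_boot all_fingroup.

Set Implicit Arguments.
Unset Strict Implicit.
Unset Printing Implicit Defensive.

Definition subst_at (S : Type) (n : nat) (x : n.-tuple S) (i : 'I_n) (y : S) :
    n.-tuple S :=
  [tuple if j == i then y else tnth x j | j < n].

(* The tuple z = (z_0, z_1, ..., z_n) satisfies z_0 = f (z_1, ..., z_n). *)
Definition satisfies (S : Type) (n : nat) (f : n.-tuple S -> S)
    (z : n.+1.-tuple S) : Prop :=
  tnth z ord0 = f [tuple tnth z (lift ord0 i) | i < n].

(* "Uniquely specifies" means existence and uniqueness of the remaining entry;
   on an infinite set these two requirements are independent. *)
Definition quasigroup (S : Type) (n : nat) (f : n.-tuple S -> S) : Prop :=
  forall (i : 'I_n.+1) (z : n.+1.-tuple S),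
    exists! y : S, satisfies f (subst_at z i y).

(* The casts identify 'I_(k + (n - k)) with 'I_n: the 0-based positions are
   i for i < k (arguments of g) and k + j for j < n - k (remaining arguments
   of h). *)
Definition reducible (S : Type) (n : nat) (f : n.-tuple S -> S) : Prop :=
  exists (k : nat) (lt1k : 1 < k) (ltkn : k < n) (sigma : 'S_n)
         (h : (n - k).+1.-tuple S -> S) (g : k.-tuple S -> S),
    [/\ quasigroup h, quasigroup g &
      forall x : n.-tuple S,
        let pos (i : 'I_(k + (n - k))) : 'I_n :=
          sigma (cast_ord (subnKC (ltnW ltkn)) i) in
        f x = h [tuple of g [tuple tnth x (pos (lshift (n - k) i)) | i < k]
                       :: [tuple tnth x (pos (rshift k j)) | j < n - k]]].

(* Main.v *)
(** Write [q] and [f] as compositions along argument sets [A] and [B].  Being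
    decomposable along [A] lets one trade the arguments in [A] for arguments
    that equal [o] except at one chosen place of [A], without changing the
    value; since [1 < #|A|], this moves any point into the region where [q] and
    [f] agree.  If [A] and [B] are disjoint, trading in [A] and in [B] commutes.
    If they meet in [b] but do not cover all the arguments, trading in both, in
    either order, moves everything in [A :|: B] to [b], and comparing the two
    results at a point that equals [o] outside [A :|: B] shows that they
    coincide.  If they meet and cover, then both [q] and [f] are decomposable
    along each of [A :&: B], [A :\: B], [B :\: A]; as [n >= 4], one of these has
    two elements, and this reduces to the previous case with [A = B]. *)

Require Import Defs.
From mathcomp Require Import all_boot all_fingroup.

Set Implicit Arguments.
Unset Strict Implicit.
Unset Printing Implicit Defensive.

(** * Points mixed along a set of arguments, and decomposability *)

Definition mix (S : Type) (n : nat) (A : {set 'I_n}) (x y : n.-tuple S) :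
    n.-tuple S :=
  [tuple if i \in A then tnth x i else tnth y i | i < n].

(** Decomposability of [F] along [A] with no inner or outer function named: [F (mix A x o)] stands
    in for the inner value, and must determine the effect of the arguments in [A] under any outer
    [z]. *)
Definition separable (S : Type) (n : nat) (o : n.-tuple S)
    (F : n.-tuple S -> S) (A : {set 'I_n}) : Prop :=
  forall x x' z, F (mix A x o) = F (mix A x' o) ->
    F (mix A x z) = F (mix A x' z).

Definition agree (S : Type) (n : nat) (o : n.-tuple S)
    (q f : n.-tuple S -> S) : Prop :=
  forall x i, tnth x i = tnth o i -> q x = f x.

Lemma tnth_mix (S : Type) (n : nat) (A : {set 'I_n}) (x y : n.-tuple S) i :
  tnth (mix A x y) i = if i \in A then tnth x i else tnth y i.
Proof. by rewrite tnth_mktuple. Qed.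

Lemma tnth_subst_at (S : Type) (n : nat) (x : n.-tuple S) i t j :
  tnth (subst_at x i t) j = if j == i then t else tnth x j.
Proof. by rewrite tnth_mktuple. Qed.

Ltac mix_cases j :=
  apply: eq_from_tnth => j;
  rewrite !(tnth_mix, tnth_subst_at, in_setU, in_setI, in_setD).

Lemma agree_sym (S : Type) (n : nat) (o : n.-tuple S) q f :
  agree o q f -> agree o f q.
Proof. by move=> qf x i xi; rewrite (qf x i xi). Qed.

Lemma agree_eq (S : Type) (n : nat) (o : n.-tuple S) q f x y :
  agree o q f -> q x = q y ->
  forall i, tnth x i = tnth o i -> tnth y i = tnth o i -> f x = f y.
Proof. by move=> ag qxy i xi yi; rewrite -(ag x i xi) -(ag y i yi). Qed.

Lemma satisfies_subst (S : Type) (n : nat) (F : n.-tuple S -> S) v x i t :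
  satisfies F (subst_at [tuple of v :: tval x] (lift ord0 i) t) <->
  v = F (subst_at x i t).
Proof.
rewrite /satisfies tnth_subst_at /=.
suff -> : [tuple tnth (subst_at [tuple of v :: tval x] (lift ord0 i) t)
             (lift ord0 j) | j < n] = subst_at x i t by [].
apply: eq_from_tnth => j; rewrite tnth_mktuple !tnth_subst_at.
by rewrite (inj_eq lift_inj) tnthS.
Qed.

Lemma quasigroup_solve (S : Type) (n : nat) (F : n.-tuple S -> S) :
  quasigroup F -> forall x i v, exists t, F (subst_at x i t) = v.
Proof.
move=> qF x i v.
have [t [/satisfies_subst Ft _]] := qF (lift ord0 i) [tuple of v :: tval x].
by exists t.
Qed.

Lemma quasigroup_inj (S : Type) (n : nat) (F : n.-tuple S -> S) :
  quasigroup F -> forall x i, injective (fun t => F (subst_at x i t)).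
Proof.
move=> qF x i t s Fts.
have [r [_ r_uniq]] :=
  qF (lift ord0 i) [tuple of F (subst_at x i t) :: tval x].
transitivity r; last by apply/r_uniq/satisfies_subst.
by apply/esym/r_uniq/satisfies_subst.
Qed.

(** [A] collects the arguments of [g]. As [h] is injective in its first argument, the value with [o]
    outside [A] determines that of [g]. *)
Lemma reducible_separable (S : Type) (n : nat) (o : n.-tuple S) F :
  reducible F ->
  exists A : {set 'I_n}, [/\ 1 < #|A|, #|A| < n & separable o F A].
Proof.
case=> k [lt1k [ltkn [sigma [h [g [qh _ Fdef]]]]]].
pose pos (i : 'I_(k + (n - k))) : 'I_n :=
  sigma (cast_ord (subnKC (ltnW ltkn)) i).
have pos_inj : injective pos by move=> i j /perm_inj /cast_ord_inj.
pose A := [set pos (lshift (n - k) i) | i : 'I_k].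
have cardA : #|A| = k.
  by rewrite card_imset ?card_ord // => i j /pos_inj /lshift_inj.
have memA i : pos (lshift (n - k) i) \in A by apply: imset_f.
have memAc j : pos (rshift k j) \in A = false.
  apply/negP => /imsetP[i _ /pos_inj /eqP].
  by rewrite eq_rlshift.
exists A; rewrite cardA; split=> // x x' z.
pose G (y : n.-tuple S) := g [tuple tnth y (pos (lshift (n - k) i)) | i < k].
pose R (y : n.-tuple S) := [tuple tnth y (pos (rshift k j)) | j < n - k].
have Fmix y w : F (mix A y w) = h [tuple of G y :: R w].
  rewrite Fdef /=; congr (h [tuple of g _ :: _]).
    by apply: eq_from_tnth => i; rewrite !tnth_mktuple memA.
  by apply: eq_from_tnth => i; rewrite !tnth_mktuple memAc.
(* The form to which injectivity at place 0 applies; [G o] is a dummy entry that is overwritten. *)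
have hsubst y w : h [tuple of G y :: R w] =
    h (subst_at [tuple of G o :: R w] ord0 (G y)).
  congr h; apply: eq_from_tnth => i; rewrite tnth_subst_at.
  by case: (unliftP ord0 i) => [j|] ->; rewrite ?tnthS.
by rewrite !Fmix !hsubst => /(quasigroup_inj qh) ->.
Qed.

(** * Spikes: points equal to [o] except at one place *)

Lemma separable_spike (S : Type) (n : nat) (o : n.-tuple S) F
    (A : {set 'I_n}) b x :
  quasigroup F -> separable o F A -> b \in A ->
  exists t, forall z, F (mix A x z) = F (mix A (subst_at o b t) z).
Proof.
(* Solve for the entry at [b] with [o] outside [A]; separability then carries the equality over to
   every [z]. *)
move=> qF sepF bA; have [t Ft] := quasigroup_solve qF o b (F (mix A x o)).
exists t => z; apply: sepF; rewrite -Ft; congr F; mix_cases j.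
by case: eqP => [->|_]; rewrite ?bA ?if_same.
Qed.

Lemma card_gt1_other (T : finType) (A : {set T}) b :
  1 < #|A| -> exists2 c, c \in A & c != b.
Proof.
move=> A1; have /card_gt0P[c] : 0 < #|A :\ b|.
  by move: A1; rewrite (cardsD1 b); case: (b \in A) => //; apply: ltnW.
by rewrite in_setD1 => /andP[cb cA]; exists c.
Qed.

(** [A] has a place other than [b], and there the point still equals [o]. *)
Lemma agree_mix_spike (S : Type) (n : nat) (o : n.-tuple S) q f
    (A : {set 'I_n}) b t z :
  agree o q f -> 1 < #|A| ->
  q (mix A (subst_at o b t) z) = f (mix A (subst_at o b t) z).
Proof.
move=> qf /(card_gt1_other b)[c cA cb]; apply: (qf _ c).
by rewrite tnth_mix cA tnth_subst_at (negPf cb).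
Qed.

(** * Disjoint sets, and sets that meet without covering *)

Lemma disjoint_case (S : Type) (n : nat) (o : n.-tuple S) q f
    (A B : {set 'I_n}) :
  quasigroup q -> quasigroup f -> agree o q f ->
  separable o q A -> separable o f B -> 1 < #|A| -> 1 < #|B| ->
  [disjoint A & B] -> q =1 f.
Proof.
move=> qq qf ag sq sf A1 B1 dAB x.
have /card_gt0P[a aA] := ltnW A1; have /card_gt0P[b bB] := ltnW B1.
have [t qt] := separable_spike x qq sq aA.
have [s fs] := separable_spike x qf sf bB.
have notAB j : j \in A -> j \in B = false by apply: disjointFr.
have mixxx (C : {set 'I_n}) : x = mix C x x by mix_cases j; rewrite if_same.
rewrite {1}(mixxx A) qt (agree_mix_spike _ _ _ ag A1).
rewrite {2}(mixxx B) fs -(agree_mix_spike _ _ _ ag B1).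
set xA := mix A _ x; set xB := mix B _ x.
(* Each trade leaves the other set untouched, so the second one can follow; both orders end at the
   same point. *)
have -> : xA = mix B x xA.
  by mix_cases j; case: (boolP (j \in A)) => [/notAB ->|_]; rewrite ?if_same.
have -> : xB = mix A x xB.
  by mix_cases j; case: (boolP (j \in A)) => [/notAB ->|_]; rewrite ?if_same.
rewrite fs qt (agree_mix_spike _ _ _ ag A1); congr f; mix_cases j.
by case: (boolP (j \in A)) => [/notAB ->|_].
Qed.

(** The trade in [A], done for [q], leaves [o] on [A] except at [b]. As [b] is also in [B], the
    trade in [B], done for [f], absorbs that entry. *)
Lemma meeting_spike (S : Type) (n : nat) (o : n.-tuple S) q f
    (A B : {set 'I_n}) b x :
  quasigroup q -> quasigroup f -> agree o q f ->
  separable o q A -> separable o f B -> 1 < #|A| -> b \in A -> b \in B ->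
  exists v, forall z,
    q (mix (A :|: B) x z) = f (mix (A :|: B) (subst_at o b v) z).
Proof.
move=> qq qf ag sq sf A1 bA bB.
have [y qy] := separable_spike x qq sq bA.
have [v fv] := separable_spike (mix A (subst_at o b y) x) qf sf bB.
exists v => z.
have -> : mix (A :|: B) x z = mix A x (mix B x z).
  by mix_cases j; case: (j \in A).
rewrite qy (agree_mix_spike _ _ _ ag A1).
have -> : mix A (subst_at o b y) (mix B x z) =
    mix B (mix A (subst_at o b y) x) (mix A (subst_at o b y) z).
  by mix_cases j; case: (j \in A); rewrite ?if_same.
rewrite fv; congr f; mix_cases j; case: eqP => [->|_]; first by rewrite bA bB.
by case: (j \in A); case: (j \in B).
Qed.

Lemma meeting_case (S : Type) (n : nat) (o : n.-tuple S) q f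
    (A B : {set 'I_n}) b c :
  quasigroup q -> quasigroup f -> agree o q f ->
  separable o q A -> separable o f B -> 1 < #|A| -> 1 < #|B| ->
  b \in A -> b \in B -> c \notin A :|: B -> q =1 f.
Proof.
move=> qq qf ag sq sf A1 B1 bA bB cAB x.
have [v qv] := meeting_spike x qq qf ag sq sf A1 bA bB.
have [u] := meeting_spike x qf qq (agree_sym ag) sf sq B1 bB bA.
rewrite setUC => fu.
have U1 : 1 < #|A :|: B|.
  by apply: leq_trans A1 (subset_leq_card (subsetUl _ _)).
have mixE t : mix (A :|: B) (subst_at o b t) o = subst_at o b t.
  by mix_cases j; case: eqP => [->|_]; rewrite ?bA ?if_same.
(* The place [c] makes [q] and [f] agree at [mix (A :|: B) x o], so [f] takes one value at both
   spikes. *)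
have uv : u = v.
  apply: (quasigroup_inj qf (x := o) (i := b)).
  rewrite /= -(mixE u) -(mixE v) -qv -(agree_mix_spike _ _ _ ag U1).
  rewrite -fu; apply/esym/(ag _ c).
  by rewrite tnth_mix (negPf cAB).
have -> : x = mix (A :|: B) x x by mix_cases j; rewrite if_same.
by rewrite qv fu uv (agree_mix_spike _ _ _ ag U1).
Qed.

(** * Covering sets: decomposability along the intersection and differences *)

Lemma separableI (S : Type) (n : nat) (o : n.-tuple S) q f
    (A B : {set 'I_n}) c :
  agree o q f -> separable o q A -> separable o f B ->
  A :|: B = setT -> c \notin A -> separable o q (A :&: B).
Proof.
move=> ag sq sf AB cA x x' z; have ag' := agree_sym ag.
have inB j : j \notin A -> j \in B.
  by move=> jA; have := in_setT j; rewrite -AB in_setU (negPf jA).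
have cB := inB c cA.
have mixAB y : mix (A :&: B) y o = mix B (mix A y o) o.
  by mix_cases j; case: (j \in A); case: (j \in B).
(* The points equal [o] at [c], so the equality passes to [f], which puts [z] outside [B]. As [c] is
   in [B], it passes back to [q], which puts [z] outside [A]. *)
move=> /(agree_eq ag)/(_ c).
rewrite !mixAB !tnth_mix (negPf cA) cB => /(_ erefl erefl)/(sf _ _ z).
have mixBA y : mix B (mix A y o) z = mix A (mix B y z) o.
  by mix_cases j; case: (boolP (j \in A)) => [|/inB ->].
move=> /(agree_eq ag')/(_ c).
rewrite !mixBA !tnth_mix (negPf cA) => /(_ erefl erefl)/(sq _ _ z).
have mixI y : mix A (mix B y z) z = mix (A :&: B) y z.
  by mix_cases j; case: (j \in A).
by rewrite !mixI.
Qed.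

Lemma separableD_r (S : Type) (n : nat) (o : n.-tuple S) q f
    (A B : {set 'I_n}) b c :
  quasigroup f -> agree o q f -> separable o q A -> separable o f B ->
  A :|: B = setT -> b \in A -> b \in B -> c \notin A ->
  separable o f (A :\: B).
Proof.
move=> qf ag sq sf AB bA bB cA x x' z.
have inB j : j \notin A -> j \in B.
  by move=> jA; have := in_setT j; rewrite -AB in_setU (negPf jA).
have cB := inB c cA.
have neq_c j : j \in A -> (j == c) = false.
  by move=> jA; apply: contraNF cA => /eqP <-.
have mixA y : mix (A :\: B) y o = mix A (mix (A :\: B) y o) o.
  by mix_cases j; case: (j \in A); rewrite ?andbF.
(* By covering, [B] is the complement of [A :\: B], so [z] can be replaced by a spike at [c]. This
   spike is [o] on [A], and its entry at [c] can be supplied by separability of [q] along [A]. *)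
have [t ft] := separable_spike z qf sf cB.
have mixB y : f (mix (A :\: B) y z) =
    f (mix A (mix (A :\: B) y o) (subst_at o c t)).
  transitivity (f (mix B z (mix (A :\: B) y z))).
    congr f; mix_cases j.
    by case: (boolP (j \in A)) => [_|/inB ->]; case: (j \in B).
  rewrite ft; congr f; mix_cases j.
  case: (boolP (j \in A)) => [/neq_c ->|/inB -> //].
  by case: (j \in B).
move=> /(agree_eq (agree_sym ag))/(_ c); rewrite mixA (mixA x') !tnth_mix.
rewrite (negPf cA) => /(_ erefl erefl)/(sq _ _ (subst_at o c t)).
move=> /(agree_eq ag)/(_ b); rewrite !tnth_mix bA in_setD bB.
by rewrite !mixB => /(_ erefl erefl).
Qed.

Lemma separableD_l (S : Type) (n : nat) (o : n.-tuple S) q f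
    (A B : {set 'I_n}) c :
  agree o q f -> separable o q A -> separable o f (A :\: B) ->
  c \notin A -> separable o q (A :\: B).
Proof.
move=> ag sq sf cA x x' z.
move=> /(agree_eq ag)/(_ c); rewrite !tnth_mix in_setD (negPf cA) andbF.
(* The filler [mix A z o] brings [z] into [A :&: B] but keeps [o] at [c], so the equality can return
   to [q], which fills in the rest. *)
move=> /(_ erefl erefl)/(sf _ _ (mix A z o)).
have mixA y : mix (A :\: B) y (mix A z o) = mix A (mix (A :\: B) y z) o.
  by mix_cases j; case: (j \in A); rewrite ?andbF.
move=> /(agree_eq (agree_sym ag))/(_ c).
rewrite !mixA !tnth_mix (negPf cA) => /(_ erefl erefl)/(sq _ _ z).
have mixD y : mix A (mix (A :\: B) y z) z = mix (A :\: B) y z.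
  by mix_cases j; case: (j \in A); rewrite ?andbF.
by rewrite !mixD.
Qed.

Lemma common_case (S : Type) (n : nat) (o : n.-tuple S) q f (A : {set 'I_n}) c :
  quasigroup q -> quasigroup f -> agree o q f ->
  separable o q A -> separable o f A -> 1 < #|A| -> c \notin A -> q =1 f.
Proof.
move=> qq qf ag sq sf A1 cA; have /card_gt0P[b bA] := ltnW A1.
apply: (meeting_case qq qf ag sq sf A1 A1 bA bA (c := c)).
by rewrite setUid.
Qed.

Lemma covering_case (S : Type) (n : nat) (o : n.-tuple S) q f
    (A B : {set 'I_n}) b c d :
  4 <= n -> quasigroup q -> quasigroup f -> agree o q f ->
  separable o q A -> separable o f B ->
  A :|: B = setT -> b \in A -> b \in B -> c \notin A -> d \notin B ->
  q =1 f.
Proof.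
move=> n4 qq qf ag sq sf AB bA bB cA dB.
have ag' := agree_sym ag; have BA : B :|: A = setT by rewrite setUC.
have cardE : #|A :&: B| + #|A :\: B| + #|B :\: A| = n.
  have -> : B :\: A = ~: A.
    apply/setP => j; have := in_setT j; rewrite -AB in_setU in_setD in_setC.
    by case: (j \in A).
  by rewrite cardsID cardsC card_ord.
(* Each piece is needed for both functions; the missing halves come from exchanging [q], [A] with
   [f], [B]. *)
have sPf := separableD_r qf ag sq sf AB bA bB cA.
have sPq := separableD_l ag sq sPf cA.
have sQq := separableD_r qq ag' sf sq BA bB bA dB.
have sQf := separableD_l ag' sf sQq dB.
have sIq := separableI ag sq sf AB cA.
have := separableI ag' sf sq BA dB; rewrite setIC => sIf.
have [I1|I1] := ltnP 1 #|A :&: B|.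
  apply: (common_case qq qf ag sIq sIf I1 (c := c)).
  by rewrite in_setI (negPf cA).
have [P1|P1] := ltnP 1 #|A :\: B|.
  apply: (common_case qq qf ag sPq sPf P1 (c := c)).
  by rewrite in_setD (negPf cA) andbF.
have [Q1|Q1] := ltnP 1 #|B :\: A|.
  apply: (common_case qq qf ag sQq sQf Q1 (c := d)).
  by rewrite in_setD (negPf dB) andbF.
have := leq_add (leq_add I1 P1) Q1; rewrite cardE => n3.
by have := leq_trans n4 n3.
Qed.

(** * Assembling the cases *)

Lemma card_lt_notin (n : nat) (A : {set 'I_n}) :
  #|A| < n -> exists c, c \notin A.
Proof.
move=> An; have /card_gt0P[c] : 0 < #|~: A|.
  by rewrite -(ltn_add2l #|A|) addn0 cardsC card_ord.
by rewrite inE => cA; exists c.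
Qed.

Theorem theorem1 (Sigma : Type) (Sigma_nonempty : inhabited Sigma) (n : nat)
    (n_ge4 : 4 <= n) (q f : n.-tuple Sigma -> Sigma)
    (q_quasi : quasigroup q) (q_red : reducible q)
    (f_quasi : quasigroup f) (f_red : reducible f)
    (o : n.-tuple Sigma)
    (eq_qf : forall (i : 'I_n) (x : n.-tuple Sigma),
       q (subst_at x i (tnth o i)) = f (subst_at x i (tnth o i))) :
  forall x : n.-tuple Sigma, q x = f x.
Proof.
have ag : agree o q f.
  move=> x i xi; suff -> : x = subst_at x i (tnth o i) by apply: eq_qf.
  by mix_cases j; case: eqP => [->|].
have [A [A1 An sq]] := reducible_separable o q_red.
have [B [B1 Bn sf]] := reducible_separable o f_red.
have [dAB|] := boolP [disjoint A & B].
  exact: disjoint_case q_quasi f_quasi ag sq sf A1 B1 dAB.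
rewrite -setI_eq0 => /set0Pn[b]; rewrite in_setI => /andP[bA bB].
have [AB|] := eqVneq (A :|: B) setT.
  have [c cA] := card_lt_notin An; have [d dB] := card_lt_notin Bn.
  exact: covering_case n_ge4 q_quasi f_quasi ag sq sf AB bA bB cA dB.
rewrite -subTset => /subsetPn[c _ cAB].
exact: meeting_case q_quasi f_quasi ag sq sf A1 B1 bA bB cAB.
Qed.
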